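(* Let $(X,d)$ be a metric space. Then $X$ is complete if and only if for every decreasing sequence $\{K_n\}_{n\ge 1}$ of nonempty closed bounded subsets of $X$ such that $\sum_{n=1}^{\infty} H(K_n,K_{n+1})$ converges, one has $\bigcap_{n=1}^{\infty} K_n \neq \emptyset$.
   Context: A sequence $\{K_n\}$ of subsets of $X$ is decreasing if $K_{n+1}\subset K_n$ for all $n\in\mathbb N$ (not necessarily strictly). For nonempty $A,B\subset X$, the Hausdorff distance is $H(A,B)=\max\{\sup_{x\in A} d(x,B),\ \sup_{x\in B} d(x,A)\}$, where $d(x,A)=\inf_{y\in A} d(x,y)$. *)

(* Defs.v *)
From HB Require Import structures.
From mathcomp Require Import all_boot all_order all_algebra.
From mathcomp Require Import all_classical all_reals all_analysis.

Set Implicit Arguments.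
Unset Strict Implicit.
Unset Printing Implicit Defensive.

Import Order.TTheory GRing.Theory Num.Theory.
Import numFieldNormedType.Exports.

Local Open Scope classical_set_scope.
Local Open Scope ring_scope.

(* The library's [completeType] is a structure on pointed spaces, not a predicate,
   and is phrased with Cauchy filters; this is completeness of a (possibly empty)
   metric space, phrased with Cauchy sequences. *)
Definition complete_metric (R : realType) (X : metricType R) : Prop :=
  forall u : nat -> X, cauchy (u @ \oo) -> exists l : X, u @ \oo --> l.

(* The library's [bounded_set] requires a norm. *)
Definition metric_bounded (R : realType) (X : metricType R) (A : set X) : Prop :=
  exists M : R, forall x y, A x -> A y -> mdist x y <= M.

Definition dist_to_set (R : realType) (X : metricType R) (x : X) (A : set X) : R :=
  inf [set mdist x y | y in A].

(* [sup] on R is a total function returning 0 on sets without a least upper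
   bound, so this is the Hausdorff distance only when both suprema are finite
   (and A, B nonempty), e.g. for nonempty bounded A and B. *)
Definition hausdorff_dist (R : realType) (X : metricType R) (A B : set X) : R :=
  Num.max (sup [set dist_to_set x B | x in A])
          (sup [set dist_to_set x A | x in B]).

(* Main.v *)
Require Import Defs.
From HB Require Import structures.
From mathcomp Require Import all_boot all_order all_algebra.
From mathcomp Require Import all_classical all_reals all_analysis.

Set Implicit Arguments.
Unset Strict Implicit.
Unset Printing Implicit Defensive.

Import Order.TTheory GRing.Theory Num.Theory.
Import numFieldNormedType.Exports.

Local Open Scope classical_set_scope.
Local Open Scope ring_scope.

(** Forward: since [K n.+1] lies within [H n := H(K n, K n.+1)] of every point of [K n], one
    builds [u n \in K n] with [d(u n, u n.+1) < H n + 2^-n]; this sequence is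
    Cauchy and its limit lies in every [K n].
    Backward: given a Cauchy sequence [u], the sets
    [K n := {x | limsup_k d(x, u k) <= 2^-n}] are nonempty, closed, decreasing and
    of diameter at most [2 * 2^-n], so the Hausdorff distances are summable; a common
    point [x] satisfies [limsup_k d(x, u k) = 0]. *)

Section hausdorff_distance.
Context {R : realType} {X : metricType R}.
Implicit Types (A B : set X) (x y : X).

Lemma dist_to_set_ge0 x A : 0 <= dist_to_set x A.
Proof.
rewrite /dist_to_set; have [->|/set0P[a Aa]] := eqVneq A set0.
  by rewrite image_set0 inf0.
by apply: lb_le_inf => [|_ [y _ <-]]; [exists (mdist x a), a|exact: mdist_ge0].
Qed.

Lemma dist_to_set_le x A y : A y -> dist_to_set x A <= mdist x y.
Proof.
move=> Ay; apply: ge_inf; last by exists y.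
by exists 0 => _ [z _ <-]; exact: mdist_ge0.
Qed.

Lemma dist_to_set_lt x A (e : R) : A !=set0 -> dist_to_set x A < e ->
  exists2 y, A y & mdist x y < e.
Proof.
move=> [a Aa] /inf_lt [|_ [y Ay <-] ye]; last by exists y.
by exists (mdist x a), a.
Qed.

Lemma sup_dist_to_set_ge0 A B :
  0 <= sup [set dist_to_set x B | x in A].
Proof.
(* When the set of distances is empty or unbounded above, [sup] takes its default value 0, so
   nonnegativity survives. *)
have [[[_ [x Ax _]] ubd]|/sup_out ->//] :=
  pselect (has_sup [set dist_to_set x B | x in A]).
by apply: le_trans (dist_to_set_ge0 x B) (ub_le_sup ubd _); exists x.
Qed.

Lemma hausdorff_dist_ge0 A B : 0 <= hausdorff_dist A B.
Proof. by rewrite le_max sup_dist_to_set_ge0. Qed.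

(** Boundedness of [A] bounds the distances to [B] above, so the [sup] is a genuine supremum and not
    the default 0. *)
Lemma dist_to_set_le_hausdorff A B x : metric_bounded A ->
  A x -> B `<=` A -> B !=set0 -> dist_to_set x B <= hausdorff_dist A B.
Proof.
move=> [M AM] Ax BA [b Bb]; rewrite le_max; apply/orP; left.
apply: ub_le_sup; last by exists x.
exists M => _ [y Ay <-]; apply: le_trans (dist_to_set_le y Bb) _.
by apply: AM => //; exact: BA.
Qed.

Lemma hausdorff_dist_le A B (M : R) : B `<=` A -> B !=set0 ->
  (forall x y, A x -> A y -> mdist x y <= M) -> hausdorff_dist A B <= M.
Proof.
move=> BA [b Bb] AM; have Ab := BA _ Bb; rewrite ge_max; apply/andP; split.
- apply: ge_sup; first by exists (dist_to_set b B), b.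
  by move=> _ [x Ax <-]; apply: le_trans (dist_to_set_le x Bb) (AM _ _ Ax Ab).
- apply: ge_sup; first by exists (dist_to_set b A), b.
  by move=> _ [x /BA Ax <-]; apply: le_trans (dist_to_set_le x Ab) (AM _ _ Ax Ab).
Qed.

End hausdorff_distance.

Lemma decreasing_seq_subset (T : Type) (K : nat -> set T) m n :
  (forall n, K n.+1 `<=` K n) -> (m <= n)%N -> K n `<=` K m.
Proof.
move=> dK /subnKC <-; elim: (n - m)%N => [|j IH]; first by rewrite addn0.
by rewrite addnS; exact: subset_trans (dK _) IH.
Qed.

Section cauchy_sequences.
Context {R : realType} {X : metricType R}.

Lemma mdist_le_sum (u : nat -> X) (v : nat -> R) m k :
  (forall n, mdist (u n) (u n.+1) <= v n) ->
  mdist (u m) (u (m + k)%N) <= \sum_(m <= i < m + k) v i.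
Proof.
move=> uv; elim: k => [|k IH]; first by rewrite addn0 mdistxx big_geq.
rewrite addnS big_nat_recr ?leq_addr//=.
by apply: le_trans (metric_triangle _ (u (m + k)%N) _) _; exact: lerD.
Qed.

(** By the triangle inequality, blocks of the series dominate distances between terms; a late term
    then serves as the centre of a small ball containing the tail. *)
Lemma cauchy_summable_steps (u : nat -> X) (v : nat -> R) :
  (forall n, mdist (u n) (u n.+1) <= v n) ->
  cvg (series v @ \oo) -> cauchy (u @ \oo).
Proof.
move=> uv /cvg_cauchy/cauchy_seriesP cv; apply: cauchy_exP => e e0.
have [[A B] /= [[N _ NA] [N' _ NB]] AB] := cv e e0.
exists (u (maxn N N')), (maxn N N') => // n /= mn.
rewrite ballEmdist /=.
have := mdist_le_sum (maxn N N') (n - maxn N N') uv.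
rewrite subnKC// => /le_lt_trans; apply; apply: le_lt_trans (ler_norm _) _.
apply: (AB (maxn N N', n)).
split; first by apply: NA; exact: leq_maxl.
by apply: NB; rewrite /= (leq_trans _ mn)// leq_maxr.
Qed.

Lemma cauchy_mdistP (u : nat -> X) : cauchy (u @ \oo) ->
  forall e : R, 0 < e -> exists N, forall k, (N <= k)%N -> mdist (u N) (u k) < e.
Proof.
move=> /cauchy_ballP cu e e0.
have [[A B] /= [[N _ NA] [N' _ NB]] AB] := cu e e0.
exists (maxn N N') => k; rewrite geq_max => /andP[Nk N'k].
have := AB (u (maxn N N'), u k); rewrite ballEmdist /=; apply; split => /=.
  by apply: NA; exact: leq_maxl.
exact: NB.
Qed.

(** The condition [limsup_k mdist x (u k) <= r] in epsilon form, which makes sense without knowing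
    that the distances are bounded. *)
Definition limsup_ball (u : nat -> X) (r : R) : set X :=
  [set x | forall e, 0 < e -> \forall k \near \oo, mdist x (u k) <= r + e].

Lemma limsup_ballS u (r s : R) : r <= s -> limsup_ball u r `<=` limsup_ball u s.
Proof.
move=> rs x xr e /xr; apply: filterS => k /le_trans; apply.
by rewrite lerD2r.
Qed.

Lemma limsup_ball_closed u (r : R) : closed (limsup_ball u r).
Proof.
move=> x clx e e0; have e20 : 0 < e / 2 by rewrite divr_gt0.
have [y [yK]] := clx _ (nbhsx_ballx x _ e20).
rewrite ballEmdist /= => xy; apply: filterS (yK _ e20) => k yk.
rewrite (le_trans (metric_triangle x y (u k)))// (splitr e) addrA addrC.
by rewrite lerD// ltW.
Qed.

(** Some [u k] is within [r + e / 2] of both points; the triangle inequality through it leaves a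
    slack [e] that is arbitrary. *)
Lemma limsup_ball_diam u (r : R) x y :
  limsup_ball u r x -> limsup_ball u r y -> mdist x y <= r *+ 2.
Proof.
move=> xK yK; apply/ler_addgt0Pr => e e0.
have e20 : 0 < e / 2 by rewrite divr_gt0.
have [k [xk yk]] := filter_ex (filterI (xK _ e20) (yK _ e20)).
rewrite (le_trans (metric_triangle x (u k) y))// (splitr e) mulr2n addrACA.
by rewrite lerD// metric_sym.
Qed.

(** A term of [u] beyond which the sequence stays [r]-close to that term is a witness. *)
Lemma limsup_ball_nonempty u (r : R) : cauchy (u @ \oo) -> 0 < r ->
  limsup_ball u r !=set0.
Proof.
move=> cu r0; have [N uN] := cauchy_mdistP cu r0.
exists (u N) => e e0; exists N => // k /= /uN /ltW /le_trans; apply.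
by rewrite lerDl ltW.
Qed.

End cauchy_sequences.

Lemma bigcap_nonempty_of_complete (R : realType) (X : metricType R)
    (K : nat -> set X) :
  complete_metric X ->
  (forall n, K n.+1 `<=` K n) ->
  (forall n, [/\ K n !=set0, closed (K n) & metric_bounded (K n)]) ->
  cvg (series (fun n => hausdorff_dist (K n) (K n.+1)) @ \oo) ->
  \bigcap_n K n !=set0.
Proof.
move=> cX dK K_; set H := fun n => hausdorff_dist _ _ => cH.
(* The infimum defining the distance to [K n.+1] may not be attained; the positive summable margin
   [2^-n] makes room for an actual point. *)
pose v n : R := H n + geometric 1 2^-1 n.
have cv : cvg (series v @ \oo).
  rewrite (_ : series v = series H \+ series (geometric 1 2^-1)).
    apply: is_cvgD cH _; apply: is_cvg_geometric_series.
    by rewrite ger0_norm// invf_lt1// ltr1n.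
  by apply/funext => n; rewrite /series /= big_split.
(* Putting membership in [K p.1] as a premise makes the choice function total, so it can be iterated
   by plain recursion. *)
have /choice[f fP] : forall p : nat * X, exists y,
    K p.1 p.2 -> K p.1.+1 y /\ mdist p.2 y < v p.1.
  move=> [n x] /=; have [Kx|] := pselect (K n x); last by exists x.
  have [[_ _ Kb] [Kn0 _ _]] := (K_ n, K_ n.+1).
  have [|y Ky xy] := @dist_to_set_lt _ _ x (K n.+1) (v n) Kn0; last by exists y.
  apply: le_lt_trans (dist_to_set_le_hausdorff Kb Kx (dK n) Kn0) _.
  by rewrite ltrDl /geometric /= mul1r exprn_gt0.
have [[x0 K0] _ _] := K_ 0%N.
pose u := nat_rect (fun=> X) x0 (fun n x => f (n, x)).
have uK n : K n (u n).
  by elim: n => [//|n IH]; have [] := fP (n, u n) IH.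
have uv n : mdist (u n) (u n.+1) <= v n.
  by have [_ /ltW] := fP (n, u n) (uK n).
have [l ul] := cX u (cauchy_summable_steps uv cv).
exists l => n _; have [_ clK _] := K_ n.
(* From index [n] on, the sequence stays in the closed set [K n], hence so does its limit. *)
apply: (closed_cvg _ clK _ _ ul); exists n => // k /= nk.
exact: (decreasing_seq_subset dK nk).
Qed.

Lemma complete_of_bigcap_nonempty (R : realType) (X : metricType R) :
  (forall K : nat -> set X,
    (forall n, K n.+1 `<=` K n) ->
    (forall n, [/\ K n !=set0, closed (K n) & metric_bounded (K n)]) ->
    cvg (series (fun n => hausdorff_dist (K n) (K n.+1)) @ \oo) ->
    \bigcap_n K n !=set0) ->
  complete_metric X.
Proof.
move=> hX u cu; pose r n : R := geometric 1 2^-1 n.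
have r0 n : 0 < r n by rewrite /r /geometric /= mul1r exprn_gt0.
have half_lt1 : `|2^-1 : R| < 1 by rewrite ger0_norm// invf_lt1// ltr1n.
pose K n := limsup_ball u (r n).
have dK n : K n.+1 `<=` K n.
  apply: limsup_ballS; rewrite /r /geometric /= !mul1r exprSr.
  by rewrite ler_piMr ?exprn_ge0// invf_le1// ler1n.
have Kn0 n : K n !=set0 by exact: limsup_ball_nonempty.
have [||x xK] := hX K dK.
- move=> n; split; [exact: Kn0|exact: limsup_ball_closed|].
  by exists (r n *+ 2); exact: limsup_ball_diam.
(* Since [K n.+1] lies in [K n], the Hausdorff distance is at most the diameter bound [2 * 2^-n]. *)
- apply: (@series_le_cvg _ _ (geometric 2 2^-1)) => [n|n|n|].
  + exact: hausdorff_dist_ge0.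
  + by rewrite /geometric /= mulr_ge0// exprn_ge0.
  + rewrite (_ : geometric 2 2^-1 n = r n *+ 2).
      by apply: hausdorff_dist_le => //; exact: limsup_ball_diam.
    by rewrite /r /geometric /= mul1r mulr_natl.
  + exact: is_cvg_geometric_series.
exists x; apply/metricType_numDomainType.cvgrPdist_le => e e0.
have e20 : 0 < e / 2 by rewrite divr_gt0.
have rlim : r @ \oo --> 0 by exact: cvg_geometric.
(* One level [n] with [r n < e / 2] suffices: membership of [x] in [K n] with slack [e / 2] gives
   eventual distance at most [e]. *)
have [n rn] := filter_ex (cvgr_lt 0 rlim _ e20).
have := xK n I _ e20; apply: filterS => k /le_trans; apply.
by rewrite [leRHS](splitr e) lerD2r ltW.
Qed.

Theorem theorem3p1 (R : realType) (X : metricType R) :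
  complete_metric X <->
  forall K : nat -> set X,
    (forall n, K n.+1 `<=` K n) ->
    (forall n, [/\ K n !=set0, closed (K n) & metric_bounded (K n)]) ->
    cvg (series (fun n => hausdorff_dist (K n) (K n.+1)) @ \oo) ->
    \bigcap_n K n !=set0.
Proof.
split=> [cX K|]; first exact: bigcap_nonempty_of_complete.
exact: complete_of_bigcap_nonempty.
Qed.
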